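(* Let $G(V,E)$ be an interaction network that is a directed acyclic graph with source vertex $s$ and sink vertex $t$. The greedy algorithm computes the maximum flow throughout $G$ if every vertex $v\in V\setminus\{s,t\}$ has exactly one outgoing edge; that is, under this condition the greedy flow $f(G)$ from $s$ to $t$ equals the maximum flow of $G$ from $s$ to $t$.
   Context: An interaction network is a finite directed graph $G(V,E)$ in which every edge $e=(v,u)\in E$ carries a finite sequence $e_S=\{(t_1,q_1),(t_2,q_2),\dots\}$ of interactions from $v$ to $u$; an interaction $(t_i,q_i)$ has a timestamp $t_i$ and a (nonnegative) quantity $q_i$. The graph is connected, and has a single source vertex $s$ (with no incoming edges) and a single sink vertex $t$ (with no outgoing edges). Buffers: each vertex $v$ has a buffer $B_v$. The buffer of $s$ is always $\infty$; all other buffers are initially $0$. There is no bound on how much a vertex can buffer, and buffered quantities do not expire. All interactions of the network are processed in order of time. When an interaction on edge $(v,u)$ transfers a quantity $q$, $B_v$ is decreased by $q$ (it remains $\infty$ if $v=s$) and $B_u$ is increased by $q$. Greedy algorithm and greedy flow: every interaction $(t_i,q_i)$ on an edge $(v,u)$ transfers the maximum possible quantity $q=\min\{q_i,B_v\}$, where $B_v$ is the quantity buffered at $v$ at that moment. The greedy flow $f(G)$ is the value of $B_t$ after all interactions have been processed. Maximum flow: every interaction $(t_i,q_i)$ on an edge $(v,u)$ may transfer any quantity in $[0,\min\{q_i,B_v\}]$, where $B_v$ is the quantity buffered at $v$ at that moment, the rest being reserved at $v$ for future outgoing interactions of $v$. The maximum flow of $G$ is the largest value of $B_t$, after all interactions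 have been processed, over all such choices of transferred quantities. *)

(* Defs.v *)
From HB Require Import structures.
From mathcomp Require Import all_boot all_order all_algebra.
From mathcomp Require Import boolp classical_sets reals constructive_ereal.

Set Implicit Arguments.
Unset Strict Implicit.
Unset Printing Implicit Defensive.

Import Order.TTheory GRing.Theory Num.Theory.
Local Open Scope ring_scope.

Section DirectedGraph.
Variables (V : finType) (E : {set V * V}).

Definition edge_rel : rel V := [rel v u | (v, u) \in E].

Definition incoming (v : V) : {set V * V} := [set e in E | e.2 == v]%SET.

Definition outgoing (v : V) : {set V * V} := [set e in E | e.1 == v]%SET.

(* Connectedness is that of the underlying undirected graph. *)
Definition weakly_connected : Prop :=
  forall v u : V, connect (relU edge_rel [rel x y | edge_rel y x]) v u.

(* [cycle] holds of the empty sequence, and of [:: v] iff v has a self-loop. *)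
Definition acyclic : Prop := forall c : seq V, cycle edge_rel c -> c = [::].

End DirectedGraph.

(* An interaction is a pair (timestamp, quantity). The values of [eseq]
   outside [edges] are irrelevant. *)
Record network (R : realType) := Network {
  vertex : finType;
  edges : {set vertex * vertex};
  eseq : vertex * vertex -> seq (R * R);
  source : vertex;
  sink : vertex;
  network_connected : weakly_connected edges;
  sourceP : forall v, incoming edges v = finset.set0 <-> v = source;
  sinkP : forall v, outgoing edges v = finset.set0 <-> v = sink;
  quantity_ge0 : forall e i, e \in edges -> i \in eseq e -> 0 <= i.2
}.

Section Flow.
Variables (R : realType) (G : network R).

Local Open Scope ereal_scope.

Let V := vertex G.

Definition interaction : Type := ((V * V) * (R * R))%type.

Definition interactions : seq interaction :=
  [seq (e, i) | e <- enum (edges G), i <- eseq e].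

(* Timestamps need not be distinct: any arrangement of simultaneous
   interactions is allowed. *)
Definition time_ordered (o : seq interaction) : Prop :=
  perm_eq o interactions /\ sorted (fun i j => (i.2.1 <= j.2.1)%R) o.

Definition buffers : Type := V -> \bar R.

Definition initial_buffers : buffers :=
  fun v => if v == source G then +oo else 0.

(* The source buffer stays infinite because +oo - x = +oo for finite x. *)
Definition transfer (B : buffers) (e : V * V) (x : \bar R) : buffers :=
  fun w => B w - (if w == e.1 then x else 0) + (if w == e.2 then x else 0).

Definition max_transfer (B : buffers) (i : interaction) : \bar R :=
  Order.min i.2.2%:E (B i.1.1).

Definition greedy_step (B : buffers) (i : interaction) : buffers :=
  transfer B i.1 (max_transfer B i).

Definition greedy_flow (o : seq interaction) : \bar R :=
  foldl greedy_step initial_buffers o (sink G).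

(* [run B o B']: processing [o] in order from [B] can lead to [B'], each
   interaction transferring any admissible quantity. *)
Inductive run : buffers -> seq interaction -> buffers -> Prop :=
| run_nil B : run B [::] B
| run_cons B i x o B' :
    0 <= x <= max_transfer B i -> run (transfer B i.1 x) o B' ->
    run B (i :: o) B'.

Definition feasible_flows (o : seq interaction) : set (\bar R) :=
  [set f | exists2 B, run initial_buffers o B & f = B (sink G)]%classic.

Definition is_maximum_flow (o : seq interaction) (f : \bar R) : Prop :=
  feasible_flows o f /\ ubound (feasible_flows o) f.

End Flow.

(* Main.v *)
(** The state of a run is determined by the total amount [D e] moved so far over
    each edge [e]. If [v] is not the source and [e] is its only outgoing edge,
    an interaction [(t, q)] on [e] turns [D e] into at most
    [min (D e + q) (inflow D v)], with equality for the greedy run. This bound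
    is nondecreasing in [D], so the greedy run always maximises every [D e], and
    in particular the amount that has entered the sink. *)
Require Import Defs.
From mathcomp Require Import all_boot all_order all_algebra.
From mathcomp Require Import boolp classical_sets reals constructive_ereal.
From mathcomp Require Import lra.

Set Implicit Arguments.
Unset Strict Implicit.
Unset Printing Implicit Defensive.

Import Order.TTheory GRing.Theory Num.Theory.
Local Open Scope ring_scope.

Section Cumulative.
Variables (R : realType) (G : network R).

Implicit Types (D : vertex G * vertex G -> R) (e : vertex G * vertex G).
Implicit Types (v : vertex G) (B : buffers G) (i : interaction G).
Implicit Types (o : seq (interaction G)).

Definition inflow D v : R := \sum_(e in incoming (edges G) v) D e.

Definition outflow D v : R := \sum_(e in outgoing (edges G) v) D e.

(** Conservation: every buffer but that of the source starts at 0; the infinite one has to be set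
    apart. *)
Definition buffers_of D : buffers G :=
  fun v => if v == source G then +oo%E else (inflow D v - outflow D v)%:E.

Definition add_flow D e (x : R) : vertex G * vertex G -> R :=
  fun f => D f + (if f == e then x else 0).

Lemma sum_add_flow D e x (A : {set vertex G * vertex G}) :
  \sum_(f in A) add_flow D e x f =
  \sum_(f in A) D f + (if e \in A then x else 0).
Proof.
rewrite big_split /=; congr (_ + _).
rewrite -big_mkcondr /=; case: ifP => eA.
  by rewrite (big_pred1 e) // => f; rewrite /=; case: eqP => [->|]; rewrite ?eA ?andbF.
by rewrite big_pred0 // => f; case: eqP => [->|]; rewrite ?eA ?andbF.
Qed.

Lemma head_neq_source e : e \in edges G -> e.2 != source G.
Proof.
move=> eE; apply/eqP => /sourceP /setP /(_ e).
by rewrite !inE eE eqxx.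
Qed.

Lemma tail_neq_sink e : e \in edges G -> e.1 != sink G.
Proof.
move=> eE; apply/eqP => /sinkP /setP /(_ e).
by rewrite !inE eE eqxx.
Qed.

Lemma outflow_sink D : outflow D (sink G) = 0.
Proof. by rewrite /outflow (_ : outgoing _ _ = finset.set0) ?big_set0 //; apply/sinkP. Qed.

Lemma initial_buffersE : @initial_buffers R G = buffers_of (fun=> 0).
Proof.
apply/funext => v; rewrite /initial_buffers /buffers_of /inflow /outflow.
by rewrite !big1 // subr0.
Qed.

Lemma transfer_buffers_of D e (x : R) : e \in edges G ->
  transfer (buffers_of D) e x%:E = buffers_of (add_flow D e x).
Proof.
move=> eE; apply/funext => v; rewrite /transfer /buffers_of.
rewrite /inflow /outflow !sum_add_flow !inE eE /= (eq_sym v e.1) (eq_sym v e.2).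
have [->|_] := eqVneq v (source G).
  (* No edge enters the source, so its buffer at most loses the finite [x] and stays [+oo]. *)
  by rewrite (negPf (head_neq_source eE)); case: ifP.
by case: (e.1 == v); case: (e.2 == v); rewrite -?EFinN -?EFinB -?EFinD; congr (_%:E); lra.
Qed.

Lemma inflow_le D D' v : (forall e, D' e <= D e) -> inflow D' v <= inflow D v.
Proof. by move=> leD; apply: ler_sum. Qed.

(** A maximal transfer is admissible once it is nonnegative; it never exceeds the buffer of the
    tail, so buffers stay nonnegative along the way. *)
Lemma greedy_run o B : (forall i, i \in o -> 0 <= i.2.2) ->
  (forall v, 0 <= B v)%E -> run B o (foldl (@greedy_step R G) B o).
Proof.
elim: o B => [|i o IHo] B q_ge0 B_ge0 /=; first exact: run_nil.
have i_ge0 : 0 <= i.2.2 by apply: q_ge0; rewrite mem_head.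
have x_ge0 : (0 <= max_transfer B i)%E by rewrite le_min lee_fin i_ge0 B_ge0.
apply: (@run_cons _ _ _ _ (max_transfer B i)); first by rewrite x_ge0 lexx.
apply: IHo => [j jo|v]; first by apply: q_ge0; rewrite in_cons jo orbT.
apply: adde_ge0; last by case: ifP.
case: eqP => [->|_]; last by rewrite sube0.
(* The finite quantity of [i] bounds the transfer, which rules out [+oo - +oo]. *)
have x_fin : (max_transfer B i \is a fin_num)%E.
  by rewrite ge0_fin_numE // (le_lt_trans _ (ltry i.2.2)) // ge_min lexx.
by rewrite sube_ge0 ?x_fin // /max_transfer ge_min lexx orbT.
Qed.

Section OneOutgoing.
Hypothesis out1 : forall v, v != source G -> v != sink G ->
  #|outgoing (edges G) v| = 1%N.

(** The tail of an edge is never the sink, so [out1] applies to it and leaves [e] as the only term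
    of the sum. *)
Lemma outflow_tail D e : e \in edges G -> e.1 != source G ->
  outflow D e.1 = D e.
Proof.
move=> eE e1s; have /eqP/cards1P[f outE] := out1 e1s (tail_neq_sink eE).
have : e \in outgoing (edges G) e.1 by rewrite inE eE eqxx.
by rewrite /outflow outE big_set1 inE => /eqP->.
Qed.

Lemma max_transfer_buffers_of D i : i.1 \in edges G ->
  max_transfer (buffers_of D) i =
  (if i.1.1 == source G then i.2.2
   else Num.min i.2.2 (inflow D i.1.1 - D i.1))%:E.
Proof.
move=> iE; rewrite /max_transfer /buffers_of.
have [_|i1s] := eqVneq i.1.1 (source G); first by rewrite min_l ?leey.
by rewrite -EFin_min outflow_tail.
Qed.

(** Induction along the run; the two states are kept separate because they may diverge at any
    interaction, and only [D' <= D] on every edge is preserved. *)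
Lemma run_le_greedy o B B' D D' : (forall i, i \in o -> i.1 \in edges G) ->
    (forall e, D' e <= D e) -> run B o B' -> B = buffers_of D' ->
  (B' (sink G) <= foldl (@greedy_step R G) (buffers_of D) o (sink G))%E.
Proof.
move=> oE leD runB; elim: runB D D' oE leD => {o B B'}
  [B|B i x o B' /andP[x_ge0 x_le] _ IHo] D D' oE leD defB.
  (* Nothing leaves the sink, so its buffer is its inflow, or [+oo] on both sides if it is also the
     source. *)
  rewrite defB /= /buffers_of !outflow_sink !subr0.
  by case: eqP => // _; rewrite lee_fin inflow_le.
have iE : i.1 \in edges G by apply: oE; rewrite mem_head.
have {}oE j : j \in o -> j.1 \in edges G by move=> jo; apply: oE; rewrite in_cons jo orbT.
rewrite {B}defB in x_le IHo *; rewrite max_transfer_buffers_of // in x_le.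
(* The bounds on [x] are finite, hence so is [x]. *)
case: x x_ge0 x_le IHo => // x; rewrite !lee_fin => x_ge0 x_le IHo.
rewrite /= /greedy_step max_transfer_buffers_of // transfer_buffers_of //.
apply: (IHo _ (add_flow D' i.1 x)) => // [e|]; last exact: transfer_buffers_of.
rewrite /add_flow; case: (eqVneq e i.1) => [->|_]; last by rewrite !addr0.
have leDi := leD i.1; have := inflow_le i.1.1 leD.
move: x_le; case: eqP => _ //; first by lra.
(* Greedy reaches either [D e + q], at least [D' e + x] as [x <= q], or [inflow D v], at least
   [inflow D' v] and so at least [D' e + x]. *)
by rewrite le_min => /andP[? ?] ?; case: (leP i.2.2) => ?; lra.
Qed.

End OneOutgoing.
End Cumulative.

Theorem lemma2 (R : realType) (G : network R)
    (o : seq (interaction G)) (o_ordered : time_ordered o)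
    (G_acyclic : acyclic (edges G))
    (G_out1 : forall v : vertex G, v != source G -> v != sink G ->
       #|outgoing (edges G) v| = 1%N) :
  is_maximum_flow o (greedy_flow o).
Proof.
have oP i : i \in o -> i.1 \in edges G /\ i.2 \in eseq i.1.
  rewrite (perm_mem o_ordered.1) => /allpairsPdep[e [j [eE jS ->]]] /=.
  by rewrite mem_enum in eE.
split.
  exists (foldl (@greedy_step R G) (@initial_buffers R G) o) => //.
  apply: greedy_run => [i /oP[iE iS]|v]; first exact: quantity_ge0 iE iS.
  by rewrite /initial_buffers; case: ifP; rewrite ?leey ?lexx.
move=> _ [B runB ->]; rewrite /greedy_flow initial_buffersE.
apply: (run_le_greedy G_out1 (D' := fun=> 0) _ _ runB) => // [i /oP[]//|].
exact: initial_buffersE.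
Qed.
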